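(* Let $G=(V,E)$ be a triangle-free graph with $V=[n]$ and $m=|E|$ edges, and let $k$ be a positive integer. For each edge $e=\{i,j\}\in E$ let $x_e=e_i+e_j\in\mathbb{R}^n$, where $e_i$ denotes the $i$-th standard basis vector. Suppose the point set $\{x_e: e\in E\}$ admits a partition into $k$ clusters $\mathcal{F}_1,\dots,\mathcal{F}_k$ whose $k$-means cost $\sum_{i=1}^k\sum_{e\in\mathcal{F}_i}\|x_e-\mu_{\mathcal{F}_i}\|^2$ (with $\mu_{\mathcal{F}_i}$ the mean of the points in $\mathcal{F}_i$) is at most $m-(1-\delta)k$, for some $\delta\ge 0$. Then $G$ has a vertex cover of size at most $(1+O(\delta))k$, i.e. at most $(1+C\delta)k$ for an absolute constant $C$.
   Context: A graph is triangle-free if it contains no 3-cycle. A vertex cover of $G$ is a set of vertices meeting every edge. *)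

(* Defs.v *)
From mathcomp Require Import all_boot all_order all_algebra.
From mathcomp Require Import reals.

Set Implicit Arguments.
Unset Strict Implicit.
Unset Printing Implicit Defensive.

Import Order.TTheory GRing.Theory Num.Theory.

Local Open Scope ring_scope.

(* A graph on the vertex set 'I_n is given by its edge set, a set of
   2-element subsets of 'I_n. *)
Definition simple_graph (n : nat) (E : {set {set 'I_n}}) : Prop :=
  forall e : {set 'I_n}, e \in E -> #|e| = 2.

Definition triangle_free (n : nat) (E : {set {set 'I_n}}) : Prop :=
  ~ exists a b c : 'I_n,
      [/\ uniq [:: a; b; c],
          [set a; b] \in E, [set b; c] \in E & [set c; a] \in E].

Definition vertex_cover (n : nat) (E : {set {set 'I_n}}) (S : {set 'I_n}) :
    Prop :=
  forall e : {set 'I_n}, e \in E -> S :&: e != set0.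

(* For e = {i, j} with i != j, this is e_i + e_j. *)
Definition edge_point (R : realType) (n : nat) (e : {set 'I_n}) : 'rV[R]_n :=
  \sum_(i in e) delta_mx 0 i.

(* The library's norm on row vectors is the sup norm, hence this definition of
   the squared Euclidean one. *)
Definition sqnorm (R : realType) (n : nat) (v : 'rV[R]_n) : R :=
  \sum_(j < n) v 0 j ^+ 2.

Definition cluster_mean (R : realType) (n : nat) (F : {set {set 'I_n}}) :
    'rV[R]_n :=
  #|F|%:R^-1 *: \sum_(e in F) edge_point R e.

(* The clusters F i may be empty; an empty cluster contributes an empty sum to
   the cost, so the junk value of its mean is irrelevant. *)
Definition clustering (n k : nat) (E : {set {set 'I_n}})
    (F : 'I_k -> {set {set 'I_n}}) : Prop :=
  \bigcup_(i < k) F i = E /\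
  (forall i j : 'I_k, i != j -> [disjoint F i & F j]).

Definition kmeans_cost (R : realType) (n k : nat)
    (F : 'I_k -> {set {set 'I_n}}) : R :=
  \sum_(i < k) \sum_(e in F i) sqnorm (edge_point R e - cluster_mean R (F i)).

(* Main.v *)
Require Import Defs.
From mathcomp Require Import all_boot all_order all_algebra.
From mathcomp Require Import reals.
From mathcomp Require Import zify ring lra.

(** For a cluster [F] with [m > 0] edges, let [D] be the number of ordered pairs
    of disjoint edges of [F].  Expanding the squares, the cost of [F] is
    [2 m - (\sum_(e, f in F) #|e :&: f|) / m], which is at least
    [m - 1 + D / m].  So it is enough that a triangle-free [F] has a cover of
    size at most [1 + 3 D / m], and to sum over the clusters.

    Let [e] be an edge disjoint from the fewest edges, at most [D / m] of them.
    The ends of [e] and one end of each edge disjoint from [e] form a cover of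
    size at most [2 + D / m], which suffices when [D / m >= 1 / 2].  Otherwise
    every edge meets [e], and if neither end of [e] covers [F], triangle-freeness
    makes every edge other than [e] disjoint from some edge, so [D >= m - 1],
    a contradiction. *)

Import Order.TTheory GRing.Theory Num.Theory.

Set Implicit Arguments.
Unset Strict Implicit.
Unset Printing Implicit Defensive.

Definition disjoint_edges (n : nat) (F : {set {set 'I_n}}) (e : {set 'I_n}) :
    {set {set 'I_n}} :=
  [set f in F | [disjoint e & f]].

Definition disjoint_pairs (n : nat) (F : {set {set 'I_n}}) : nat :=
  \sum_(e in F) #|disjoint_edges F e|.

(** * Passing from the graph to a cluster of edges *)

Section SubGraph.
Variables (n : nat) (E F : {set {set 'I_n}}).
Hypothesis sFE : F \subset E.

Lemma simple_graphS : simple_graph E -> simple_graph F.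
Proof. by move=> gE e /(subsetP sFE); apply: gE. Qed.

Lemma triangle_freeS : triangle_free E -> triangle_free F.
Proof.
move=> tE [a [b [c [abc ab bc ca]]]]; apply: tE; exists a, b, c.
by split => //; apply: (subsetP sFE).
Qed.

End SubGraph.

(** * Disjoint edges and small covers *)

Section Cover.
Variables (n : nat) (F : {set {set 'I_n}}).
Hypothesis gF : simple_graph F.

Lemma edge_pair (e : {set 'I_n}) (u v : 'I_n) :
  e \in F -> u \in e -> v \in e -> u != v -> e = [set u; v].
Proof.
move=> eF ue ve uv; apply/esym/eqP; rewrite eqEcard cards2 uv (gF eF) leqnn.
by rewrite andbT; apply/subsetP => x /set2P [] ->.
Qed.

(** Distinct 2-sets share at most one vertex, and none when disjoint; the term [e == f] pays for the
    second vertex shared on the diagonal. *)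
Lemma card_edgeI (e f : {set 'I_n}) : e \in F -> f \in F ->
  #|e :&: f| + [disjoint e & f] <= 1 + (e == f).
Proof.
move=> eF fF; have [->|nef] := eqVneq e f.
  by rewrite setIid -setI_eq0 setIid -cards_eq0 (gF fF).
rewrite -setI_eq0 addn0; have [->|nef0] := eqVneq; first by rewrite cards0.
rewrite addn0 leqNgt; apply: contraNN nef => lt1.
apply/eqP; transitivity (e :&: f); apply/eqP; rewrite 1?[_ == e :&: f]eq_sym.
  by rewrite eqEcard subsetIl (gF eF).
by rewrite eqEcard subsetIr (gF fF).
Qed.

Lemma sum_card_edgeI :
  \sum_(e in F) \sum_(f in F) #|e :&: f| + disjoint_pairs F
    <= #|F| ^ 2 + #|F|.
Proof.
rewrite /disjoint_pairs -big_split /=.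
have -> : #|F| ^ 2 + #|F| = \sum_(e in F) (#|F| + 1).
  by rewrite sum_nat_const; lia.
apply: leq_sum => e eF.
have -> : #|disjoint_edges F e| = \sum_(f in F) [disjoint e & f].
  rewrite -sum1_card [RHS]big_mkcond [LHS]big_mkcond /=.
  by apply: eq_bigr => f _; rewrite inE; case: (f \in F); case: [disjoint e & f].
rewrite -big_split /=.
have -> : #|F| + 1 = \sum_(f in F) (1 + (e == f)).
  rewrite big_split /= sum1_card; congr (_ + _).
  rewrite (bigD1 e) //= eqxx big1 // => f /andP[_].
  by rewrite eq_sym => /negbTE ->.
by apply: leq_sum => f fF; apply: card_edgeI.
Qed.

Lemma cover_edge_and_disjoint (e : {set 'I_n}) : e \in F ->
  exists S : {set 'I_n},
    vertex_cover F S /\ #|S| <= 2 + #|disjoint_edges F e|.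
Proof.
move=> eF.
have [u ue] : exists u, u \in e by apply/set0Pn; rewrite -card_gt0 (gF eF).
pose end_of (f : {set 'I_n}) := odflt u [pick x in f].
exists (e :|: end_of @: disjoint_edges F e); split; last first.
  by rewrite (leq_trans (leq_card_setU _ _)) // (gF eF) leq_add2l leq_imset_card.
move=> f fF; apply/set0Pn.
have [dj|] := boolP [disjoint e & f]; last first.
  rewrite -setI_eq0 => /set0Pn [x /setIP [xe xf]].
  by exists x; rewrite !inE xe xf.
exists (end_of f); rewrite !inE; apply/andP; split.
  by apply/orP; right; apply: imset_f; rewrite inE fF.
rewrite /end_of; case: pickP => //= f0.
by have := gF fF; rewrite (eq_card0 f0).
Qed.

Hypothesis tF : triangle_free F.

(** A common vertex [x] would give [h = [set u; x]] and [f = [set v; x]], closing a triangle on [u],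
    [v], [x]. *)
Lemma adjacent_edges_disjoint (u v : 'I_n) (f h : {set 'I_n}) : u != v ->
  [set u; v] \in F -> f \in F -> h \in F ->
  v \in f -> u \notin f -> u \in h -> v \notin h -> [disjoint h & f].
Proof.
move=> uv eF fF hF vf uf uh vh; rewrite -setI_eq0.
apply: contraT => /set0Pn [x /setIP [xh xf]]; case: tF.
have vx : v != x by apply: contraNneq vh => ->.
have xu : x != u by apply: contraNneq uf => <-.
exists u, v, x; split=> //.
- by rewrite /= !inE negb_or uv vx eq_sym xu.
- by rewrite -(edge_pair fF).
- by rewrite -(edge_pair hF).
Qed.

(** The bound [1 + 3 D / m], multiplied by [m] to stay in the naturals. *)
Lemma small_cover : exists S : {set 'I_n},
  vertex_cover F S /\ #|F| * #|S| <= #|F| + 3 * disjoint_pairs F.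
Proof.
have [->|[e0 e0F]] := set_0Vmem F.
  by exists set0; rewrite cards0; split=> // e; rewrite inE.
pose N e := #|disjoint_edges F e|.
have [e eF emin] : exists2 e, e \in F & forall f, f \in F -> N e <= N f.
  by case: (arg_minnP N e0F) => e eF emin; exists e.
have leD : #|F| * N e <= disjoint_pairs F.
  by rewrite -sum_nat_const; apply: leq_sum.
have [S [covS cardS]] := cover_edge_and_disjoint eF; rewrite -/(N e) in cardS.
(* If [m <= 2 D], then [m (2 + N e) <= 2 m + D <= m + 3 D]. Otherwise [m * N e <= D < m] forces
   [N e = 0]. *)
have [le2D|lt2D] := leqP #|F| (2 * disjoint_pairs F).
  exists S; split=> //; rewrite (leq_trans (leq_mul (leqnn _) cardS)) //.
  by rewrite mulnDr; lia.
have Ne0 : N e = 0 by nia.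
have meet f : f \in F -> ~~ [disjoint e & f].
  move=> fF; apply/negP => dj.
  by move/eqP: Ne0; rewrite cards_eq0 => /eqP/setP/(_ f); rewrite !inE fF dj.
have [u [v [uv eE]]] : exists u v, u != v /\ e = [set u; v].
  have /eqP/cards2P [u [v [uv ->]]] := gF eF; by exists u, v.
rewrite {}eE in eF meet {emin leD covS cardS Ne0}.
have meetuv f : f \in F -> (u \in f) || (v \in f).
  move/meet; rewrite -setI_eq0 => /set0Pn [x /setIP [/set2P [] -> ->]] //.
  by rewrite orbT.
have [/forallP covu|] := boolP [forall f, (f \in F) ==> (u \in f)].
  exists [set u]; rewrite cards1; split; last lia.
  move=> f fF; apply/set0Pn; exists u; rewrite !inE eqxx.
  by have := covu f; rewrite fF.
rewrite negb_forall => /existsP [f]; rewrite negb_imply => /andP [fF uf].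
have [/forallP covv|] := boolP [forall f, (f \in F) ==> (v \in f)].
  exists [set v]; rewrite cards1; split; last lia.
  move=> h hF; apply/set0Pn; exists v; rewrite !inE eqxx.
  by have := covv h; rewrite hF.
rewrite negb_forall => /existsP [g]; rewrite negb_imply => /andP [gF' vg].
have vf : v \in f by have := meetuv f fF; rewrite (negbTE uf).
have ug : u \in g by have := meetuv g gF'; rewrite (negbTE vg) orbF.
(* An edge other than [[set u; v]] contains exactly one of [u] and [v]: with [u] it is disjoint from
   [f], with [v] from [g]. *)
have Npos h : h \in F :\ [set u; v] -> 0 < N h.
  case/setD1P => hne hF; rewrite card_gt0; apply/set0Pn.
  have [uh|uh] := boolP (u \in h).
    exists f; rewrite !inE fF /=.
    apply: (adjacent_edges_disjoint uv) => //.
    by apply: contraNN hne => vh; rewrite -(edge_pair hF).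
  exists g; rewrite !inE gF' /= disjoint_sym.
  apply: (adjacent_edges_disjoint uv) => //.
  by have := meetuv h hF; rewrite (negbTE uh).
(* This excludes [m = 1], where [D >= m - 1] would not contradict [2 D < m]. *)
have F2 : 0 < #|F :\ [set u; v]|.
  rewrite card_gt0; apply/set0Pn; exists f; rewrite !inE fF andbT.
  by apply: contraNneq uf => ->; rewrite !inE eqxx.
have geD : #|F :\ [set u; v]| <= disjoint_pairs F.
  rewrite -sum1_card /disjoint_pairs (big_setD1 _ eF) /=.
  by apply: leq_trans (leq_addl _ _); apply: leq_sum.
exfalso; move: (cardsD1 [set u; v] F) F2 geD lt2D; rewrite eF /=.
by set a := #|_ :\ _|; set m := #|_|; lia.
Qed.

End Cover.

Local Open Scope ring_scope.

(** * The cost of one cluster *)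

Lemma edge_pointE (R : realType) (n : nat) (e : {set 'I_n}) (j : 'I_n) :
  edge_point R e 0 j = (j \in e)%:R.
Proof.
rewrite /edge_point summxE; under eq_bigr do rewrite mxE eqxx /=.
have [je|je] := boolP (j \in e).
  rewrite (bigD1 j) //= eqxx big1 ?addr0 // => i /andP [_].
  by rewrite eq_sym => /negbTE ->.
by rewrite big1 // => i ie; case: eqP => // ji; rewrite ji ie in je.
Qed.

(** The variance identity, to be applied in each coordinate. *)
Lemma sum_sqr_sub_mean (K : fieldType) (T : finType) (A : {set T}) (x : T -> K) :
  #|A|%:R != 0 :> K ->
  #|A|%:R * \sum_(e in A) (x e - #|A|%:R^-1 * \sum_(f in A) x f) ^+ 2 =
  #|A|%:R * (\sum_(e in A) x e ^+ 2) - (\sum_(f in A) x f) ^+ 2.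
Proof.
move=> A0; set M := \sum_(f in A) x f; set m := #|A|%:R.
have -> : \sum_(e in A) (x e - m^-1 * M) ^+ 2 =
          \sum_(e in A) x e ^+ 2 - 2 * (m^-1 * M) * M + m * (m^-1 * M) ^+ 2.
  rewrite [2 * _ * M]mulr_sumr /m -sumr_const mulr_suml -sumrB -big_split /=.
  by apply: eq_bigr => e _; rewrite /m; ring.
by field.
Qed.

Section Cost.
Variables (R : realType) (n : nat) (F : {set {set 'I_n}}).
Hypothesis gF : simple_graph F.

Local Notation cost :=
  (\sum_(e in F) sqnorm (edge_point R e - cluster_mean R F)).

Lemma cluster_costE : #|F|%:R * cost =
  2 * #|F|%:R ^+ 2 - (\sum_(e in F) \sum_(f in F) #|e :&: f|)%:R.
Proof.
have [F0|Fn0] := eqVneq F set0.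
  by rewrite F0 !big_set0 cards0; ring.
have m0 : #|F|%:R != 0 :> R by rewrite pnatr_eq0 cards_eq0.
pose x (j : 'I_n) (e : {set 'I_n}) : R := (j \in e)%:R.
have -> : cost =
    \sum_(j < n) \sum_(e in F) (x j e - #|F|%:R^-1 * \sum_(f in F) x j f) ^+ 2.
  rewrite exchange_big /=; apply: eq_bigr => j _; apply: eq_bigr => e _.
  rewrite !mxE edge_pointE summxE; congr ((_ - _ * _) ^+ 2).
  by apply: eq_bigr => f _; rewrite edge_pointE.
rewrite [LHS]mulr_sumr.
under [LHS]eq_bigr => j _ do rewrite (sum_sqr_sub_mean (x j)) //.
have sum_x (A : {set 'I_n}) : \sum_(j < n) (j \in A)%:R = #|A|%:R :> R.
  by rewrite -natr_sum -big_mkcond sum1_card.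
(* Over all coordinates, the squares of the indicators sum to [#|e| = 2] for each edge, and the
   squared coordinate sums count the common vertices of all ordered pairs of edges. *)
rewrite sumrB -mulr_sumr exchange_big /=; congr (_ - _).
  under eq_bigr => e eF.
    under eq_bigr do rewrite /x -natrX -mulnn mulnb andbb.
    rewrite sum_x gF //; over.
  by rewrite sumr_const -mulr_natr; ring.
under eq_bigr do rewrite expr2 mulr_suml.
rewrite exchange_big natr_sum; apply: eq_bigr => e eF.
under eq_bigr do rewrite mulr_sumr.
rewrite exchange_big natr_sum; apply: eq_bigr => f fF /=.
by rewrite -sum_x; apply: eq_bigr => j _; rewrite /x -natrM mulnb inE.
Qed.

Lemma cluster_cost_ge :
  #|F|%:R ^+ 2 - #|F|%:R + (disjoint_pairs F)%:R <= #|F|%:R * cost.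
Proof.
have := sum_card_edgeI gF.
rewrite -(ler_nat R) !natrD natrX cluster_costE; lra.
Qed.

(** For nonempty [F], [D / m <= cost - m + 1] turns [1 + 3 D / m] into [4 + 3 (cost - m)]. *)
Lemma cluster_cover : triangle_free F -> exists S : {set 'I_n},
  vertex_cover F S /\ #|S|%:R <= 4 + 3 * (cost - #|F|%:R).
Proof.
move=> tF; have [F0|Fn0] := eqVneq F set0.
  exists set0; rewrite F0 !big_set0 !cards0; split; last lra.
  by move=> e; rewrite inE.
have [S [covS cardS]] := small_cover gF tF; exists S; split=> //.
have m0 : 0 < #|F|%:R :> R by rewrite ltr0n card_gt0.
rewrite -(ler_pM2l m0); have := cluster_cost_ge.
by move: cardS; rewrite -(ler_nat R) natrD !natrM; nra.
Qed.

End Cost.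

(** * Summing over the clusters *)

Theorem theorem4 (R : realType) :
  exists C : R,
    forall (n : nat) (E : {set {set 'I_n}}),
      simple_graph E -> triangle_free E ->
    forall (k : nat), (0 < k)%N ->
    forall (delta : R), 0 <= delta ->
    forall (F : 'I_k -> {set {set 'I_n}}),
      clustering E F ->
      kmeans_cost R F <= #|E|%:R - (1 - delta) * k%:R ->
    exists S : {set 'I_n},
      vertex_cover E S /\ #|S|%:R <= (1 + C * delta) * k%:R.
Proof.
(* The cluster bounds add up to [4 k + 3 (cost - #|E|)], at most
   [4 k - 3 (1 - delta) k = (1 + 3 delta) k]. *)
exists 3 => n E gE tE k _ delta _ F [covF djF] costF.
have sFE i : F i \subset E by rewrite -covF bigcup_sup.
have /fin_all_exists [S covS] : forall i, exists S : {set 'I_n},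
    vertex_cover (F i) S /\
    #|S|%:R <= 4 + 3 * (\sum_(e in F i)
      sqnorm (edge_point R e - cluster_mean R (F i)) - #|F i|%:R).
  move=> i; apply: cluster_cover.
    exact: simple_graphS gE.
  exact: triangle_freeS tE.
exists (\bigcup_(i < k) S i); split.
  move=> e; rewrite -covF => /bigcupP [i _ eF].
  have /set0Pn [x /setIP [xS xe]] := (covS i).1 e eF.
  by apply/set0Pn; exists x; rewrite inE xe andbT; apply/bigcupP; exists i.
have cardE : (#|E| = \sum_(i < k) #|F i|)%N.
  rewrite -covF -sum1_card partition_disjoint_bigcup //.
  by apply: eq_bigr => i _; rewrite sum1_card.
have cardS : #|\bigcup_(i < k) S i|%:R <= \sum_(i < k) #|S i|%:R :> R.
  rewrite -natr_sum ler_nat; elim/big_rec2: _ => [|i B A _ le].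
    by rewrite cards0.
  by rewrite (leq_trans (leq_card_setU _ _)) // leq_add2l.
apply: (le_trans cardS); apply: le_trans.
  by apply: ler_sum => i _; apply: (covS i).2.
rewrite big_split /= sumr_const card_ord -mulr_sumr sumrB -natr_sum -cardE.
by move: costF; rewrite /kmeans_cost -mulr_natr; lra.
Qed.
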